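(* Let $\Gamma = \langle v_0,\ldots,v_g\rangle$ be a numerical semigroup with minimal generators $v_0 < \cdots < v_g$ and conductor $c$. Let $f_1,\ldots,f_n$ denote the polynomials of $S_{dec}(\Gamma)$ of weighted degree less than $c$, and for $i=1,\ldots,n$ let $f_1^{(i)},\ldots,f_{r_i}^{(i)}$ denote the coefficients of $\operatorname{red}_R(\phi_R(f_i))$, viewed as polynomials in the coefficients of the generators $x_0(t),\ldots,x_g(t)$ of $R$, i.e. as polynomial functions on $\mathbb{C}^{M(\Gamma)}$, where $$M(\Gamma) = \sum_{i=0}^g \#\{\text{gaps of } \Gamma \text{ greater than } v_i\}.$$ Then $\mathcal{R}_{\Gamma}$ is in bijection with the $\mathbb{C}$-points of the affine subvariety $$V\big(f_1^{(1)},\ldots,f_{r_1}^{(1)},\ldots,f_1^{(n)},\ldots,f_{r_n}^{(n)}\big) \subseteq \mathbb{C}^{M(\Gamma)},$$ a point of this subvariety corresponding to the ring $\mathbb{C}[x_0(t),\ldots,x_g(t)]$ generated by the set in normal form whose coefficients are the coordinates of that point.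
   Context: $\mathbb{N}$ contains $0$. A numerical semigroup $\Gamma \subseteq \mathbb{N}$ is a subset containing $0$, closed under addition, and containing all sufficiently large integers; its conductor $c$ is the element with $c-1 \notin \Gamma$ and $n \in \Gamma$ for all $n \geq c$. A gap of $\Gamma$ is an element of $\mathbb{N}\setminus\Gamma$. $\mathcal{R}_\Gamma$ is the set of complete $\mathbb{C}$-subalgebras of $\mathbb{C}[[t]]$ with semigroup (set of orders of nonzero elements) equal to $\Gamma$. Since every such subalgebra contains the ideal $(t^c)$, $\mathcal{R}_\Gamma$ is identified with the set of $\mathbb{C}$-subalgebras $R$ of $\mathbb{C}[t]/(t^c)$ with $\Gamma_R = \Gamma$, where $\Gamma_R = \{n \mid \exists f \in R\setminus\{0\},\ \operatorname{ord} f = n\} \cup \{n \in \mathbb{N} \mid n \geq c\}$. A set $\{x_0(t),\ldots,x_g(t)\} \subset \mathbb{C}[t]/(t^c)$ is in normal form (with respect to $\Gamma$) if for each $i$, $x_i(t)$ is monic of order $v_i$ (leading term, i.e. lowest-order term, $t^{v_i}$) and all other powers of $t$ appearing in $x_i(t)$ with non-zero coefficient are gaps of $\Gamma$; that is, $x_i(t) = t^{v_i} + \sum_{\delta} a_{i,\delta}t^\delta$, the sum over gaps $\delta > v_i$ (so $x_i(t)=0$ in $\mathbb{C}[t]/(t^c)$ when $v_i \geq c$). Sets in normal form are identified with points $(a_{i,\delta})$ of $\mathbb{C}^{M(\Gamma)}$. For such a set put $R = \mathbb{C}[x_0(t),\ldots,x_g(t)] \subseteq \mathbb{C}[t]/(t^c)$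 and let $\phi_R : \mathbb{C}[x_0,\ldots,x_g] \to R$ be the ring homomorphism $x_i \mapsto x_i(t)$. The ring $\mathbb{C}[x_0,\ldots,x_g]$ is graded with $x_i$ of weight $v_i$. Reduction map: for each positive $n \in \Gamma$ with $n < c$, let $(i_0,\ldots,i_g) \in \mathbb{N}^{g+1}$ be the smallest solution of $\sum_j i_j v_j = n$ with respect to reverse lexicographic ordering (tuples are compared at the largest index where they differ), and let $p_n(t) = x_0(t)^{i_0}\cdots x_g(t)^{i_g} \in R$, a monic element of order $n$. For $r(t) \in R$, $\operatorname{red}_R(r(t)) \in R$ is obtained from $r(t)$ by successively removing, in increasing order of $n$, each power $t^n$ with $0<n\in\Gamma$, $n<c$, appearing with non-zero coefficient, by subtracting the appropriate multiple of $p_n(t)$. $S_{dec}(\Gamma)$ is the set of polynomials $x_0^{i_0}\cdots x_g^{i_g} - x_0^{i_0'}\cdots x_g^{i_g'}$ with (i) $i_j,i_j' \in \mathbb{N}$ and $(i_0,\ldots,i_g) \neq (i_0',\ldots,i_g')$; (ii) $i_m < i_m'$ where $m$ is the smallest $j$ with $i_j \neq i_j'$; (iii) $\sum_{j=0}^g i_j v_j = \sum_{j=0}^g i_j' v_j$ (this common value is the weighted degree). *)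

(* Defs.v *)
From HB Require Import structures.
From mathcomp Require Import all_boot all_order all_algebra.
From mathcomp Require Import qpoly complex.
From mathcomp Require Import boolp classical_sets functions reals.
From mathcomp Require Import mpoly.

Set Implicit Arguments.
Unset Strict Implicit.
Unset Printing Implicit Defensive.

Import GRing.Theory.
Local Open Scope classical_set_scope.
Local Open Scope ring_scope.

Definition numerical_semigroup (Gamma : set nat) : Prop :=
  [/\ Gamma 0%N,
      (forall m n, Gamma m -> Gamma n -> Gamma (m + n)%N) &
      exists N, forall n, (N <= n)%N -> Gamma n].

(* For c = 0 the condition "c - 1 is not in Gamma" holds, as -1 is not in N. *)
Definition conductor (Gamma : set nat) (c : nat) : Prop :=
  ((0 < c)%N -> ~ Gamma c.-1) /\ (forall n, (c <= n)%N -> Gamma n).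

Definition wdeg (n : nat) (v : 'I_n -> nat) (m : 'X_{1.. n}) : nat :=
  (\sum_(j < n) m j * v j)%N.

Definition minimal_generators (Gamma : set nat) (n : nat) (v : 'I_n -> nat) :
    Prop :=
  [/\ (forall i j : 'I_n, (i < j)%N -> (v i < v j)%N),
      Gamma = [set d | exists m, wdeg v m = d] &
      forall i, Gamma <> [set d | exists2 m : 'X_{1.. n}, m i = 0%N & wdeg v m = d]].

(* K[t]/(t^c).  When c = 0 the library replaces the modulus 1 by 'X, so that
   this is K rather than the zero ring; c = 0 only occurs for Gamma = N, whose
   unique subalgebra K[[t]] then corresponds to K instead of 0. *)
Notation tpoly K c := {poly %/ ('X^c : {poly K})}.

Definition has_order (K : comNzRingType) (c : nat) (r : tpoly K c) (n : nat) :
    Prop :=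
  r`_n != 0 /\ forall k, (k < n)%N -> r`_k = 0.

Definition semigroup_of (K : comNzRingType) (c : nat) (S : set (tpoly K c)) :
    set nat :=
  [set n | (exists2 r, S r & has_order r n) \/ (c <= n)%N].

Definition RGamma (K : comNzRingType) (Gamma : set nat) (c : nat) :
    set (set (tpoly K c)) :=
  [set S : set (tpoly K c) | GRing.subalg_closed (mem S) /\ semigroup_of S = Gamma].

(* Every gap is smaller than the conductor c. *)
Definition gaps_above (Gamma : set nat) (c n : nat) : seq nat :=
  [seq d <- iota 0 c | (n < d)%N && (d \notin Gamma)].

Definition M (Gamma : set nat) (c n : nat) (v : 'I_n -> nat) : nat :=
  (\sum_(i < n) size (gaps_above Gamma c (v i)))%N.

(* The i-th element of the set in normal form with coefficients a; the
   coordinate a_(i, delta), for delta the j-th gap above v i, has index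
   tagnat.Rank i j in 'I_(M Gamma c v). *)
Definition normal_form (K : comNzRingType) (Gamma : set nat) (c n : nat)
    (v : 'I_n -> nat) (a : 'I_(M Gamma c v) -> K) (i : 'I_n) : tpoly K c :=
  in_qpoly 'X^c
    ('X^(v i) +
     \sum_(j < size (gaps_above Gamma c (v i)))
       a (tagnat.Rank (p_ := fun k => size (gaps_above Gamma c (v k))) i j)
         *: 'X^(nth 0%N (gaps_above Gamma c (v i)) j)).

(* phi_R, with the coefficients of the polynomial transported along iota. *)
Definition phi (K L : comNzRingType) (iota : K -> L) (c n : nat)
    (x : 'I_n -> tpoly L c) : {mpoly K[n]} -> tpoly L c :=
  mmap (fun a => qpolyC 'X^c (iota a)) x.

Definition generated_algebra (K : comNzRingType) (c n : nat)
    (x : 'I_n -> tpoly K c) : set (tpoly K c) :=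
  range (phi idfun x).

Definition revlex_lt (n : nat) (m m' : 'X_{1.. n}) : bool :=
  [exists k : 'I_n,
     (m k < m' k)%N && [forall j : 'I_n, (k < j)%N ==> (m j == m' j)]].

(* When all v j are positive, every solution of wdeg v m = d has total degree
   at most d, so that the bounded search is exhaustive. *)
Definition min_solution (n : nat) (v : 'I_n -> nat) (d : nat) : 'X_{1.. n} :=
  if [pick m : 'X_{1.. n < d.+1} |
        (wdeg v m == d) &&
        [forall m' : 'X_{1.. n < d.+1},
           (wdeg v m' == d) && (m' != m) ==> revlex_lt m m']] is Some m
  then bmnm m else 0%MM.

Definition monic_monomial (K : comNzRingType) (c n : nat) (v : 'I_n -> nat)
    (x : 'I_n -> tpoly K c) (d : nat) : tpoly K c :=
  \prod_(j < n) x j ^+ min_solution v d j.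

Definition red (K : comNzRingType) (Gamma : set nat) (c n : nat)
    (v : 'I_n -> nat) (x : 'I_n -> tpoly K c) (r : tpoly K c) : tpoly K c :=
  foldl (fun (s : tpoly K c) d => s - s`_d *: monic_monomial v x d) r
    [seq d <- iota 1 c.-1 | d \in Gamma].

(* The elements of S_dec of weighted degree d. *)
Definition S_dec (K : comNzRingType) (n : nat) (v : 'I_n -> nat) (d : nat) :
    set {mpoly K[n]} :=
  [set f | exists m m' : 'X_{1.. n},
     [/\ m != m',
         (exists2 k : 'I_n, (m k < m' k)%N &
                            forall j : 'I_n, (j < k)%N -> m j = m' j),
         wdeg v m = d, wdeg v m' = d &
         f = 'X_[m] - 'X_[m']]].

(* The generators of R are taken with indeterminate coefficients, over the
   coordinate ring of the affine space; red makes sense there because the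
   monomials p_n(t) are monic. *)
Definition red_coefficients (K : comNzRingType) (Gamma : set nat) (c n : nat)
    (v : 'I_n -> nat) : set {mpoly K[M Gamma c v]} :=
  let x := normal_form (fun k => 'X_k : {mpoly K[M Gamma c v]}) in
  [set F | exists d (f : {mpoly K[n]}) k,
     [/\ (d < c)%N, S_dec v d f &
         F = (red Gamma v x (phi (@mpolyC _ K) x f))`_k]].

Definition zero_locus (K : comNzRingType) (N : nat) (P : set {mpoly K[N]}) :
    set {ffun 'I_N -> K} :=
  [set a | forall F, P F -> F.@[a] = 0].

Lemma coef_in_qpolyXn (K : comNzRingType) (c : nat) (p : {poly K}) k :
  (in_qpoly 'X^c p)`_k = if (k < c.-1.+1)%N then p`_k else 0.
Proof.
rewrite -[in LHS](poly_take_drop c.-1.+1 p) in_qpolyD.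
rewrite -[X in (_ * X)](mk_monic_Xn K c).
have -> : in_qpoly 'X^c (drop_poly c.-1.+1 p * mk_monic 'X^c) = 0.
  apply/val_inj => /=.
  by rewrite Pdiv.RingMonic.rmodp_mull // monic_mk_monic.
rewrite addr0 in_qpoly_small ?coef_take_poly //.
by rewrite mk_monic_Xn size_polyXn ltnS size_take_poly.
Qed.

Lemma tpoly_coef_default (K : comNzRingType) (c : nat) (q : tpoly K c) k :
  (c.-1.+1 <= k)%N -> q`_k = 0.
Proof.
have E : size (mk_monic 'X^c : {poly K}) = c.-1.+2.
  by rewrite mk_monic_Xn size_polyXn.
by move=> ck; rewrite nth_default //; apply: leq_trans ck;
  rewrite -ltnS -E size_mk_monic.
Qed.

Lemma in_qpoly_val (K : comNzRingType) (c : nat) (q : tpoly K c) :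
  in_qpoly 'X^c (q : {poly K}) = q.
Proof.
apply/npolyP => k; rewrite coef_in_qpolyXn; case: ltnP => // ck.
by rewrite tpoly_coef_default.
Qed.

Definition tmap (K L : comNzRingType) (h : {rmorphism K -> L}) (c : nat)
    (q : tpoly K c) : tpoly L c :=
  in_qpoly 'X^c (map_poly h q).

Lemma coef_tmap (K L : comNzRingType) (h : {rmorphism K -> L}) c
    (q : tpoly K c) k :
  (tmap h q)`_k = h q`_k.
Proof.
rewrite coef_in_qpolyXn coef_map; case: ltnP => // ck.
by rewrite tpoly_coef_default ?rmorph0.
Qed.

Lemma tmap_in_qpoly (K L : comNzRingType) (h : {rmorphism K -> L}) c p :
  tmap h (in_qpoly 'X^c p) = in_qpoly 'X^c (map_poly h p).
Proof.
apply/npolyP => k; rewrite coef_tmap !coef_in_qpolyXn coef_map.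
by case: ifP; rewrite ?rmorph0.
Qed.

Lemma tmap_zmod_morphism (K L : comNzRingType) (h : {rmorphism K -> L}) c :
  zmod_morphism (@tmap K L h c).
Proof. by move=> p q; apply/npolyP=> k; rewrite !(coef_tmap, coefB) rmorphB. Qed.

Lemma tmap_monoid_morphism (K L : comNzRingType) (h : {rmorphism K -> L}) c :
  monoid_morphism (@tmap K L h c).
Proof.
split; first by rewrite -in_qpoly1 tmap_in_qpoly rmorph1 in_qpoly1.
move=> p q; rewrite -{1}(in_qpoly_val p) -{1}(in_qpoly_val q) -in_qpolyM.
by rewrite tmap_in_qpoly rmorphM in_qpolyM.
Qed.

HB.instance Definition _ (K L : comNzRingType) (h : {rmorphism K -> L}) c :=
  GRing.isZmodMorphism.Build _ _ (@tmap K L h c) (@tmap_zmod_morphism K L h c).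
HB.instance Definition _ (K L : comNzRingType) (h : {rmorphism K -> L}) c :=
  GRing.isMonoidMorphism.Build _ _ (@tmap K L h c) (@tmap_monoid_morphism K L h c).

Lemma tmapZ (K L : comNzRingType) (h : {rmorphism K -> L}) c a
    (q : tpoly K c) :
  tmap h (a *: q) = h a *: tmap h q.
Proof. by apply/npolyP=> k; rewrite coef_tmap !coefZ coef_tmap rmorphM. Qed.

Lemma tmap_qpolyC (K L : comNzRingType) (h : {rmorphism K -> L}) c a :
  tmap h (qpolyC 'X^c a) = qpolyC 'X^c (h a).
Proof.
apply/npolyP=> k; rewrite coef_tmap !qpolyCE !coefC.
by case: eqP; rewrite ?rmorph0.
Qed.

Lemma tmap_normal_form (K L : comNzRingType) (h : {rmorphism K -> L})
    Gamma c n (v : 'I_n -> nat) (a : 'I_(M Gamma c v) -> K) i :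
  tmap h (normal_form a i) = normal_form (fun k => h (a k)) i.
Proof.
rewrite /normal_form tmap_in_qpoly rmorphD /= map_polyXn rmorph_sum.
congr (in_qpoly _ (_ + _)).
by apply: eq_bigr => j _; rewrite /= map_polyZ map_polyXn.
Qed.

Lemma tmap_red (K L : comNzRingType) (h : {rmorphism K -> L})
    Gamma c n (v : 'I_n -> nat) (x : 'I_n -> tpoly K c) r :
  tmap h (red Gamma v x r) = red Gamma v (fun i => tmap h (x i)) (tmap h r).
Proof.
rewrite /red; elim: [seq _ <- _ | _] r => //= d s IH r; rewrite IH; congr foldl.
rewrite rmorphB /= tmapZ coef_tmap; congr (_ - _ *: _).
by rewrite rmorph_prod; apply: eq_bigr => j _; rewrite rmorphXn.
Qed.

Lemma tmap_phi (K0 K L : comNzRingType) (h : {rmorphism K -> L})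
    (iota : K0 -> K) c n (x : 'I_n -> tpoly K c) f :
  tmap h (phi iota x f) = phi (fun a => h (iota a)) (fun i => tmap h (x i)) f.
Proof.
rewrite /phi /mmap rmorph_sum; apply: eq_bigr => m _.
rewrite rmorphM /= tmap_qpolyC; congr (_ * _).
by rewrite /mmap1 rmorph_prod; apply: eq_bigr => j _; rewrite rmorphXn.
Qed.

(* The polynomial function defined by a coefficient of the generic reduction
   sends a point a to that coefficient of red_R (phi_R f), for R the ring
   generated by the set in normal form with coefficients a. *)
Lemma red_phi_meval (K : comNzRingType) Gamma c n (v : 'I_n -> nat)
    (a : 'I_(M Gamma c v) -> K) (f : {mpoly K[n]}) k :
  let x := normal_form (fun k => 'X_k : {mpoly K[M Gamma c v]}) in
  meval a (red Gamma v x (phi (@mpolyC _ K) x f))`_k =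
  (red Gamma v (normal_form a) (phi idfun (normal_form a) f))`_k.
Proof.
move=> x; have Ex : (fun i => tmap (meval a) (x i)) = normal_form a.
  apply/funext => i; rewrite tmap_normal_form.
  by congr normal_form; apply/funext => j; exact: mevalXU.
rewrite -(coef_tmap (meval a)) tmap_red tmap_phi Ex.
have -> // : (fun b => meval a (mpolyC (M Gamma c v) b)) = idfun.
by apply/funext => b; exact: mevalC.
Qed.

(* Main.v *)
Require Import Defs.
From mathcomp Require Import all_boot all_order all_algebra.
From mathcomp Require Import qpoly complex.
From mathcomp Require Import boolp classical_sets functions reals.
From mathcomp Require Import mpoly.

(** Write [x_i] for the generators in normal form with coefficients [a], [R] for
    the algebra that they generate and [p_d] for the chosen monic monomial of
    order [d].  The theorem rests on one feature of truncated polynomials: if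
    the orders of the nonzero elements of a set all lie in [Gamma], then an
    element of it without any term [t^k], [k] in [Gamma], is zero
    ([semigroup_coef0]).

    Reduction subtracts multiples of the [p_d], hence does not change
    membership in [R], and leaves a constant plus terms at gaps.  So if [R] has
    semigroup [Gamma], the reduction of every element of [R] of zero constant
    term vanishes ([red_eq0]); applied to the binomials, this is the vanishing
    of the equations.

    Conversely, the equations compare each monomial in the [x_i] of order
    [0 < d < c] with [p_d], whose reduction is zero; so they say exactly
    that all those monomials reduce to zero ([zero_locusP]).  By linearity each
    element of [R] then reduces to a constant.  But an element whose order is a
    gap keeps its leading coefficient under reduction, so the order of a
    nonzero element of [R] is in [Gamma] ([RGamma_generated]).

    The point can be recovered from the ring, since the difference of two
    normal forms of the same generator only has terms at gaps
    ([normal_form_inj]).  Every algebra [S] with semigroup [Gamma] is reached: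
    it contains an element of order [v_i], from which elements of [S] of larger
    order remove all terms above [v_i] that are not at gaps
    ([normal_form_gens_exist]).  These normal forms generate [S], because
    reducing an element of [S] that has zero constant term gives zero
    ([RGamma_eq_generated]). *)

Import GRing.Theory.
Local Open Scope classical_set_scope.
Local Open Scope ring_scope.

(** * Reduction against monic elements *)

Lemma coef_subZ {K : comNzRingType} {c} (r q : tpoly K c) a k :
  (r - a *: q)`_k = r`_k - a * q`_k.
Proof. by rewrite coefB coefZ. Qed.

Lemma coef_subZ_id {K : comNzRingType} {c} (r q : tpoly K c) a k :
  a = 0 \/ q`_k = 0 -> (r - a *: q)`_k = r`_k.
Proof. by rewrite coef_subZ; case=> ->; rewrite ?mul0r ?mulr0 subr0. Qed.

(** The reduction map with the order of the steps and the subtracted elements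
    as parameters: it is applied both to the monomials [p_d] and to arbitrary
    elements of an algebra with semigroup [Gamma]. *)
Definition reduce {K : comNzRingType} {c} (q : nat -> tpoly K c) (ds : seq nat)
    (r : tpoly K c) : tpoly K c :=
  foldl (fun (s : tpoly K c) d => s - s`_d *: q d) r ds.

Definition monic_of_order {K : comNzRingType} {c} (r : tpoly K c) (d : nat) :=
  r`_d = 1 /\ forall k, (k < d)%N -> r`_k = 0.

Definition subspace {K : comNzRingType} {c} (S : set (tpoly K c)) :=
  S 0 /\ forall a u v, S u -> S v -> S (a *: u + v).

Lemma reduce_linear {K : comNzRingType} {c} (q : nat -> tpoly K c) ds
    a (r s : tpoly K c) :
  reduce q ds (a *: r + s) = a *: reduce q ds r + reduce q ds s.
Proof.
elim: ds r s => //= d ds IH r s; rewrite -IH; congr (reduce q ds _).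
apply/npolyP => k; rewrite !(coefB, coefD, coefZ) mulrDl mulrBr mulrA.
by rewrite opprD addrACA.
Qed.

Lemma reduce_id {K : comNzRingType} {c} (q : nat -> tpoly K c) ds
    (r : tpoly K c) :
  (forall d, d \in ds -> r`_d = 0) -> reduce q ds r = r.
Proof.
elim: ds => //= d ds IH r0; rewrite r0 ?mem_head // scale0r subr0.
by apply: IH => e eds; rewrite r0 // inE eds orbT.
Qed.

(** Each step changes the element by a multiple of an element of [S]; the
    equivalence is what allows one to deduce that an element lies in [S] from
    its reduction. *)
Lemma mem_reduce {K : comNzRingType} {c} (S : set (tpoly K c)) q ds
    (r : tpoly K c) :
  subspace S -> (forall d, d \in ds -> S (q d)) ->
  S (reduce q ds r) <-> S r.
Proof.
move=> [S0 SZD]; elim: ds r => [//|d ds IH] r Sq /=.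
rewrite IH; last by move=> e eds; apply: Sq; rewrite inE eds orbT.
have Sqd : S (q d) by apply: Sq; rewrite mem_head.
split=> [Sr|Sr].
  by rewrite -[r](subrK (r`_d *: q d)) addrC; apply: SZD.
by rewrite addrC -scaleNr; apply: SZD.
Qed.

Lemma coef_reduce_gt {K : comNzRingType} {c} (q : nat -> tpoly K c) ds
    (r : tpoly K c) k :
  (forall d, d \in ds -> monic_of_order (q d) d /\ (k < d)%N) ->
  (reduce q ds r)`_k = r`_k.
Proof.
elim: ds r => //= d ds IH r qds.
rewrite IH => [|e eds]; last by apply: qds; rewrite inE eds orbT.
have [[_ q0] kd] := qds d (mem_head _ _).
by rewrite coef_subZ_id //; right; exact: q0.
Qed.

(** The steps below the order [n] subtract zero, and those above [n] only alter
    coefficients above [n]; this is how a gap order is detected after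
    reduction. *)
Lemma coef_reduce_order {K : comNzRingType} {c} (q : nat -> tpoly K c) ds
    (r : tpoly K c) n :
  (forall d, d \in ds -> monic_of_order (q d) d) ->
  (forall k, (k < n)%N -> r`_k = 0) ->
  (forall k, (k < n)%N -> (reduce q ds r)`_k = 0) /\
  (n \notin ds -> (reduce q ds r)`_n = r`_n).
Proof.
elim: ds r => [//|d ds IH] r qds r0 /=.
have [q1 q0] := qds d (mem_head _ _).
have {}qds e : e \in ds -> monic_of_order (q e) e.
  by move=> eds; apply: qds; rewrite inE eds orbT.
have s0 k : (k < n)%N -> (r - r`_d *: q d)`_k = 0.
  move=> kn; rewrite coef_subZ_id; first exact: r0.
  have [dn|nd] := ltnP d n; first by left; exact: r0.
  by right; apply: q0; apply: leq_trans kn nd.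
have [H1 H2] := IH _ qds s0; split=> // nds.
rewrite inE negb_or in nds; case/andP: nds => nd nds.
rewrite H2 // coef_subZ_id //.
move: nd; case: (ltngtP n d) => // dn _; first by right; exact: q0.
by left; exact: r0.
Qed.

(** Once the step [d] has cancelled the coefficient of [t^d], the later steps
    subtract elements of order larger than [d]. *)
Lemma coef_reduce_mem {K : comNzRingType} {c} (q : nat -> tpoly K c) ds
    (r : tpoly K c) d :
  (forall d, d \in ds -> monic_of_order (q d) d) -> sorted ltn ds ->
  d \in ds -> (reduce q ds r)`_d = 0.
Proof.
elim: ds r => [//|e ds IH] r qds /=.
rewrite path_sortedE; last exact: ltn_trans.
case/andP=> /allP dse sds.
have qds' f : f \in ds -> monic_of_order (q f) f.
  by move=> fds; apply: qds; rewrite inE fds orbT.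
rewrite inE => /predU1P[-> | dds]; last exact: IH.
rewrite coef_reduce_gt => [|f fds]; last by split; [exact: qds'|exact: dse].
by have [q1 _] := qds e (mem_head _ _); rewrite coef_subZ q1 mulr1 subrr.
Qed.

(** The steps before [d] subtract zero, and the step [d] subtracts [q d]
    itself. *)
Lemma reduce_self {K : comNzRingType} {c} (q : nat -> tpoly K c) ds d :
  (forall d, d \in ds -> monic_of_order (q d) d) -> sorted ltn ds ->
  d \in ds -> reduce q ds (q d) = 0.
Proof.
elim: ds => [//|e ds IH] qds /=.
rewrite path_sortedE; last exact: ltn_trans.
case/andP=> /allP dse sds.
have qds' f : f \in ds -> monic_of_order (q f) f.
  by move=> fds; apply: qds; rewrite inE fds orbT.
rewrite inE => /predU1P[-> | dds].
  have [q1 _] := qds e (mem_head _ _).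
  by rewrite q1 scale1r subrr reduce_id // => f _; rewrite coef0.
have [_ q0] := qds' d dds.
by rewrite q0 ?scale0r ?subr0; [exact: IH | exact: dse].
Qed.

(** * Leading terms modulo a power of t *)

(** [r] is [t^d] times a power series of constant term [1], modulo [t^c].  For
    [d] beyond the truncation this makes [r] zero, so that orders add up in
    products without any case distinction. *)
Definition leading_term {K : comNzRingType} {c} (r : tpoly K c) (d : nat) :=
  exists2 p : {poly K}, p`_0 = 1 & r = in_qpoly 'X^c ('X^d * p).

Lemma leading_term_monic {K : comNzRingType} {c} (r : tpoly K c) d :
  leading_term r d -> (d < c.-1.+1)%N -> monic_of_order r d.
Proof.
move=> [p p1 ->] dc; split=> [|k kd]; rewrite coef_in_qpolyXn coefXnM.
  by rewrite dc ltnn subnn.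
by rewrite kd; case: ifP.
Qed.

Lemma leading_term_eq0 {K : comNzRingType} {c} (r : tpoly K c) d :
  leading_term r d -> (c.-1 < d)%N -> r = 0.
Proof.
move=> [p p1 ->] cd; apply/npolyP => k; rewrite coef_in_qpolyXn coefXnM coef0.
by case: ltnP => // kc; rewrite (leq_trans kc cd).
Qed.

Lemma leading_termM {K : comNzRingType} {c} (r s : tpoly K c) d e :
  leading_term r d -> leading_term s e -> leading_term (r * s) (d + e).
Proof.
move=> [p p1 ->] [q q1 ->]; exists (p * q); first by rewrite coef0M p1 q1 mulr1.
by rewrite -in_qpolyM exprD mulrACA.
Qed.

Lemma leading_term1 {K : comNzRingType} {c} : leading_term (1 : tpoly K c) 0.
Proof.
by exists 1; [rewrite coef1 | rewrite expr0 mulr1 in_qpoly1].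
Qed.

Lemma leading_term_mmap1 {K : comNzRingType} {c n} (x : 'I_n -> tpoly K c) v m :
  (forall i, leading_term (x i) (v i)) -> leading_term (mmap1 x m) (wdeg v m).
Proof.
move=> xv; rewrite /mmap1 /wdeg.
elim/big_rec2: _ => [|i d r _ IH]; first exact: leading_term1.
apply: leading_termM IH; elim: (m i) => [|e IH].
  by rewrite expr0; exact: leading_term1.
by rewrite exprS mulSn; exact: leading_termM.
Qed.

(** * Minimal solutions for the reverse lexicographic order *)

Lemma revlex_lt_trans {n} : transitive (@revlex_lt n).
Proof.
move=> m2 m1 m3 /existsP[k /andP[k12 /forallP e12]].
move=> /existsP[l /andP[l23 /forallP e23]]; apply/existsP.
have {}e12 (j : 'I_n) : (k < j)%N -> m1 j = m2 j.
  by move=> h; apply/eqP/(implyP (e12 j)).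
have {}e23 (j : 'I_n) : (l < j)%N -> m2 j = m3 j.
  by move=> h; apply/eqP/(implyP (e23 j)).
have [kl|lk|kl] := ltngtP k l.
- exists l; rewrite e12 // l23; apply/forallP => j; apply/implyP => lj.
  by rewrite e12 ?e23 // (ltn_trans kl).
- exists k; rewrite -e23 // k12; apply/forallP => j; apply/implyP => kj.
  by rewrite e12 ?e23 // (ltn_trans lk).
- have {}kl := val_inj kl; subst l.
  exists k; rewrite (ltn_trans k12 l23); apply/forallP => j; apply/implyP => kj.
  by rewrite e12 ?e23.
Qed.

Lemma mnm_neq_ex {n} (m m' : 'X_{1.. n}) : m != m' -> exists k, m k != m' k.
Proof.
move=> mm'; apply/existsP; apply: contraR mm' => /existsPn H.
by apply/eqP/mnmP => k; apply/eqP; rewrite -[_ == _]negbK H.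
Qed.

(** The comparison is decided at the largest index where the exponents
    differ. *)
Lemma revlex_lt_total {n} (m m' : 'X_{1.. n}) :
  m != m' -> revlex_lt m m' || revlex_lt m' m.
Proof.
move=> /mnm_neq_ex[k0 H0].
have [k Hk kmax] := @arg_maxnP _ k0 (fun k => m k != m' k) (@nat_of_ord n) H0.
have e (j : 'I_n) : (k < j)%N -> m j = m' j.
  by move=> kj; apply/eqP; apply: contraLR kj => /kmax; rewrite -leqNgt.
case: (ltngtP (m k) (m' k)) Hk => // lt _; apply/orP; [left|right];
  apply/existsP; exists k; rewrite lt; apply/forallP => j; apply/implyP => kj;
  by rewrite e.
Qed.

Lemma mdeg_le_wdeg {n} {v : 'I_n -> nat} (m : 'X_{1.. n}) :
  (forall i, 0 < v i)%N -> (mdeg m <= wdeg v m)%N.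
Proof.
by move=> v0; rewrite mdegE; apply: leq_sum => i _; rewrite leq_pmulr.
Qed.

Lemma wdeg_eq0 {n} {v : 'I_n -> nat} (m : 'X_{1.. n}) :
  (forall i, 0 < v i)%N -> wdeg v m = 0%N -> m = 0%MM.
Proof.
by move=> v0 m0; apply/eqP; rewrite -mdeg_eq0 -leqn0 -m0 mdeg_le_wdeg.
Qed.

(** The search in [min_solution] is over a finite set totally ordered by
    [revlex_lt], which contains [m] because the weights are positive; hence it
    does return a minimum. *)
Lemma wdeg_min_solution {n} {v : 'I_n -> nat} (m : 'X_{1.. n}) :
  (forall i, 0 < v i)%N -> wdeg v (min_solution v (wdeg v m)) = wdeg v m.
Proof.
move=> v0; set d := wdeg v m; rewrite /min_solution.
case: pickP => [m' /andP[/eqP-> //]|none].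
have md : (mdeg m < d.+1)%N by rewrite ltnS mdeg_le_wdeg.
pose P (m' : 'X_{1.. n < d.+1}) := wdeg v m' == d.
pose le (m1 m2 : 'X_{1.. n < d.+1}) := (m1 == m2) || revlex_lt m1 m2.
have le_refl : reflexive le by move=> m1; rewrite /le eqxx.
have le_trans : transitive le.
  move=> m2 m1 m3 /predU1P[-> //|l12] /predU1P[<-|l23]; apply/orP; right=> //.
  exact: revlex_lt_trans l12 l23.
have le_total : total le.
  move=> m1 m2; rewrite /le eq_sym; have [//|/=] := eqVneq m2 m1.
  by rewrite eq_sym -(inj_eq val_inj) => /revlex_lt_total.
have P0 : P (BMultinom md) by rewrite /P.
have [i Pi imin] := extremumP id le_refl le_trans le_total P0.
have := none i; rewrite -/(P i) Pi /= => /forallP[] j; apply/implyP.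
case/andP=> Pj ji; have := imin j Pj.
by rewrite /le eq_sym (negPf ji).
Qed.

(** * Sets in normal form *)

(** A generator [0] could be dropped without changing the semigroup. *)
Lemma minimal_generators_gt0 {Gamma n} {v : 'I_n -> nat} i :
  minimal_generators Gamma v -> (0 < v i)%N.
Proof.
move=> [_ GE minG]; rewrite lt0n.
apply/eqP => vi0; apply: (minG i).
rewrite GE; apply/seteqP; split=> d; last by case=> m _ <-; exists m.
case=> m <- /=.
exists [multinom if j == i then 0%N else m j | j < n].
  by rewrite mnmE eqxx.
rewrite /wdeg; apply: eq_bigr => j _; rewrite mnmE.
by case: eqP => // ->; rewrite vi0 !muln0.
Qed.

Lemma mem_gaps {Gamma c n d} :
  d \in gaps_above Gamma c n -> [/\ (n < d)%N, ~ Gamma d & (d < c)%N].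
Proof.
rewrite mem_filter mem_iota add0n => /andP[/andP[nd /negP Gd] dc].
by split=> // /mem_set.
Qed.

Lemma notin_gaps {Gamma c n k} : conductor Gamma c ->
  k \notin gaps_above Gamma c n -> (n < k)%N -> Gamma k.
Proof.
move=> [_ hc] kn nk; have [kc|ck] := ltnP k c; last exact: hc.
apply: contrapT => Gk; move/negP: kn; apply.
rewrite mem_filter mem_iota add0n kc nk leq0n !andbT; apply/negP => Gk'.
exact: (Gk (set_mem Gk')).
Qed.

Lemma coef_normal_form {K : comNzRingType} {Gamma c n} {v : 'I_n -> nat}
    (a : 'I_(M Gamma c v) -> K) i k : (k < c.-1.+1)%N ->
  (normal_form a i)`_k = (k == v i)%:R +
   \sum_(j < size (gaps_above Gamma c (v i)))
       a (tagnat.Rank (p_ := fun k => size (gaps_above Gamma c (v k))) i j)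
         * (k == nth 0%N (gaps_above Gamma c (v i)) j)%:R.
Proof.
move=> kc; rewrite coef_in_qpolyXn kc coefD coefXn coef_sum; congr (_ + _).
by apply: eq_bigr => j _; rewrite coefZ coefXn.
Qed.

Lemma coef_normal_form_gap {K : comNzRingType} {Gamma c n} {v : 'I_n -> nat}
    (a : 'I_(M Gamma c v) -> K) i (j : 'I_(size (gaps_above Gamma c (v i)))) :
  (normal_form a i)`_(nth 0%N (gaps_above Gamma c (v i)) j) =
  a (tagnat.Rank (p_ := fun k => size (gaps_above Gamma c (v k))) i j).
Proof.
have [vd _ dc] := mem_gaps (mem_nth 0%N (ltn_ord j)).
rewrite coef_normal_form; last by rewrite (leq_trans dc) // leqSpred.
rewrite gtn_eqF // add0r (bigD1 j) //= eqxx mulr1 big1 ?addr0 // => l lj.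
rewrite nth_uniq ?filter_uniq ?iota_uniq //.
by rewrite eq_sym (negPf lj : (l == j :> nat) = false) mulr0.
Qed.

Lemma coef_normal_form_nongap {K : comNzRingType} {Gamma c n} {v : 'I_n -> nat}
    (a : 'I_(M Gamma c v) -> K) i k : (k < c.-1.+1)%N ->
  k \notin gaps_above Gamma c (v i) -> (normal_form a i)`_k = (k == v i)%:R.
Proof.
move=> kc kg; rewrite coef_normal_form // big1 ?addr0 // => j _.
by case: eqP kg => [->|_ _]; rewrite ?mulr0 ?mem_nth.
Qed.

(** Only gaps larger than [v i] occur, so [t^(v i)] can be factored out. *)
Lemma leading_term_normal_form {K : comNzRingType} {Gamma c n} {v : 'I_n -> nat}
    (a : 'I_(M Gamma c v) -> K) i : leading_term (normal_form a i) (v i).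
Proof.
set gs := gaps_above Gamma c (v i).
pose b (j : 'I_(size gs)) :=
  a (tagnat.Rank (p_ := fun k => size (gaps_above Gamma c (v k))) i j).
have gt (j : 'I_(size gs)) : (v i < nth 0%N gs j)%N.
  by have [] := mem_gaps (mem_nth 0%N (ltn_ord j)).
exists (1 + \sum_(j < size gs) b j *: 'X^(nth 0%N gs j - v i)).
  rewrite coefD coef1 coef_sum big1 ?addr0 // => j _.
  by rewrite coefZ coefXn ltn_eqF ?mulr0 // subn_gt0.
rewrite /normal_form mulrDr mulr1 mulr_sumr; congr (in_qpoly _ (_ + _)).
by apply: eq_bigr => j _; rewrite -scalerAr -exprD subnKC // ltnW.
Qed.

(** * Generated subalgebras *)

(** Expressing constants through the structure map of the algebra turns [phi]
    into evaluation along a ring morphism. *)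
Lemma phiE {K : comNzRingType} {c n} (x : 'I_n -> tpoly K c) f :
  phi idfun x f = mmap (in_alg (tpoly K c)) x f.
Proof.
rewrite /phi /mmap; apply: eq_bigr => m _; congr (_ * _).
apply/npolyP => k; rewrite coefZ -[1]in_qpoly1 coef_in_qpolyXn qpolyCE !coefC.
by case: k => [|k]; rewrite /= ?mulr1 //; case: ifP; rewrite mulr0.
Qed.

Lemma phiX {K : comNzRingType} {c n} (x : 'I_n -> tpoly K c) m :
  phi idfun x 'X_[m] = mmap1 x m.
Proof. by rewrite phiE mmapX. Qed.

Lemma phi_XB {K : comNzRingType} {c n} (x : 'I_n -> tpoly K c) m m' :
  phi idfun x ('X_[m] - 'X_[m']) = mmap1 x m - mmap1 x m'.
Proof. by rewrite phiE rmorphB /= !mmapX. Qed.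

Lemma subalg_closedP {K : comNzRingType} {c} (S : set (tpoly K c)) :
  GRing.subalg_closed (mem S) <->
  [/\ S 1, forall a u v, S u -> S v -> S (a *: u + v) &
      forall u v, S u -> S v -> S (u * v)].
Proof.
split=> [[S1 SZ SM]|[S1 SZ SM]]; split.
- by move/set_mem: S1.
- by move=> a u v Su Sv; apply/set_mem/SZ; apply: mem_set.
- by move=> u v Su Sv; apply/set_mem/SM; apply: mem_set.
- exact: mem_set.
- by move=> a u v /set_mem Su /set_mem Sv; apply/mem_set/SZ.
- by move=> u v /set_mem Su /set_mem Sv; apply/mem_set/SM.
Qed.

Lemma subalg_subspace {K : comNzRingType} {c} (S : set (tpoly K c)) :
  GRing.subalg_closed (mem S) -> subspace S.
Proof.
move=> /subalg_closedP[S1 SZ _]; split=> //.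
by rewrite -(addNr 1) -scaleN1r; exact: SZ.
Qed.

Lemma generated_subalg {K : comNzRingType} {c n} (x : 'I_n -> tpoly K c) :
  GRing.subalg_closed (mem (generated_algebra x)).
Proof.
apply/subalg_closedP; split.
- by exists 1 => //; rewrite phiE rmorph1.
- move=> a _ _ [p _ <-] [q _ <-]; exists (a *: p + q) => //.
  by rewrite !phiE rmorphD /= mmapZ /= mulr_algl.
- by move=> _ _ [p _ <-] [q _ <-]; exists (p * q) => //; rewrite !phiE rmorphM.
Qed.

Lemma generated_mmap1 {K : comNzRingType} {c n} (x : 'I_n -> tpoly K c) m :
  generated_algebra x (mmap1 x m).
Proof. by exists 'X_[m] => //; rewrite phiX. Qed.

Lemma generated_gen {K : comNzRingType} {c n} (x : 'I_n -> tpoly K c) i :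
  generated_algebra x (x i).
Proof. by rewrite -(mmap1U x i); exact: generated_mmap1. Qed.

Lemma generated_min_subspace {K : comNzRingType} {c n} (x : 'I_n -> tpoly K c)
    (S : set (tpoly K c)) :
  subspace S -> (forall m, S (mmap1 x m)) -> generated_algebra x `<=` S.
Proof.
move=> [S0 SZ] Sx _ [p _ <-]; rewrite phiE /mmap.
elim: (msupp p) => [|m ms IH]; first by rewrite big_nil.
by rewrite big_cons mulr_algl; apply: SZ.
Qed.

Lemma generated_min_subalg {K : comNzRingType} {c n} (x : 'I_n -> tpoly K c)
    (S : set (tpoly K c)) :
  GRing.subalg_closed (mem S) -> (forall i, S (x i)) ->
  generated_algebra x `<=` S.
Proof.
move=> algS Sx; apply: generated_min_subspace; first exact: subalg_subspace.
have [S1 _ SM] := (subalg_closedP S).1 algS.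
move=> m; apply: (big_ind S) => // i _.
by elim: (m i) => [|e IH]; rewrite ?expr0 // exprS; apply: SM.
Qed.

(** * The equations *)

(** Comparing the exponents at the first index where they differ only orients
    the binomial, so one of the two differences qualifies. *)
Lemma S_dec_binomial {K : comNzRingType} {n} {v : 'I_n -> nat}
    (m m' : 'X_{1.. n}) :
  m != m' -> wdeg v m = wdeg v m' ->
  S_dec v (wdeg v m) ('X_[m] - 'X_[m'] : {mpoly K[n]}) \/
  S_dec v (wdeg v m) ('X_[m'] - 'X_[m] : {mpoly K[n]}).
Proof.
move=> mm' E; have [k0 H0] := mnm_neq_ex _ _ mm'.
have [k Hk kmin] := @arg_minnP _ k0 (fun k => m k != m' k) (@nat_of_ord n) H0.
have e (j : 'I_n) : (j < k)%N -> m j = m' j.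
  by move=> kj; apply/eqP; apply: contraLR kj => /kmin; rewrite -leqNgt.
case: (ltngtP (m k) (m' k)) Hk => // lt _; [left|right].
  by exists m, m'; split=> //; exists k.
exists m', m; split; rewrite // 1?eq_sym //; exists k => // j jk.
by rewrite e.
Qed.

Definition red_steps (Gamma : set nat) (c : nat) :=
  [seq d <- iota 1 c.-1 | d \in Gamma].

Lemma mem_red_steps Gamma c d :
  d \in red_steps Gamma c <-> [/\ (0 < d)%N, (d < c.-1.+1)%N & Gamma d].
Proof.
rewrite mem_filter mem_iota add1n; split.
  by case/and3P=> /set_mem.
by case=> -> -> Gd; rewrite andbT andbT; exact: mem_set.
Qed.

Lemma red_steps_sorted Gamma c : sorted ltn (red_steps Gamma c).
Proof. apply: sorted_filter; [exact: ltn_trans | exact: iota_ltn_sorted]. Qed.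

Lemma redE {K : comNzRingType} {Gamma c n} {v : 'I_n -> nat}
    (x : 'I_n -> tpoly K c) r :
  red Gamma v x r = reduce (monic_monomial v x) (red_steps Gamma c) r.
Proof. by []. Qed.

Lemma monic_monomial_monic {K : comNzRingType} {Gamma c n} {v : 'I_n -> nat}
    (x : 'I_n -> tpoly K c) d :
  minimal_generators Gamma v -> (forall i, leading_term (x i) (v i)) ->
  d \in red_steps Gamma c -> monic_of_order (monic_monomial v x d) d.
Proof.
move=> hv xv /mem_red_steps[_ dc].
have v0 i : (0 < v i)%N := minimal_generators_gt0 i hv.
have [_ -> _] := hv; case=> m md; rewrite -md in dc *.
apply: leading_term_monic dc.
rewrite -[X in leading_term _ X](wdeg_min_solution m v0).
exact: leading_term_mmap1.
Qed.

(** From left to right, [m] is compared with the minimal solution [m'] of the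
    same weighted degree, as the monomial of [m'] is [p_d] and reduces to
    zero.  The binomials being differences of monomials, the converse is
    linearity of the reduction. *)
Lemma zero_locusP {K : comNzRingType} {Gamma c n} {v : 'I_n -> nat}
    (a : {ffun 'I_(M Gamma c v) -> K}) :
  minimal_generators Gamma v ->
  zero_locus (@red_coefficients K Gamma c n v) a <->
  forall m, (0 < wdeg v m < c)%N ->
    red Gamma v (normal_form a) (mmap1 (normal_form a) m) = 0.
Proof.
move=> hv; have v0 i : (0 < v i)%N := minimal_generators_gt0 i hv.
have xv := @leading_term_normal_form K Gamma c n v a.
set x := normal_form a in xv *.
have redB m m' : red Gamma v x (mmap1 x m - mmap1 x m') =
    red Gamma v x (mmap1 x m) - red Gamma v x (mmap1 x m').
  by rewrite addrC -scaleN1r !redE reduce_linear scaleN1r addrC.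
split=> [Va m /andP[d0 dc]|H F [d [f [k [dc [m [m' [mm' _ md m'd ->]] ->]]]]]].
- have Vf f : S_dec v (wdeg v m) f -> red Gamma v x (phi idfun x f) = 0.
    move=> Sf; apply/npolyP => k; rewrite coef0 -red_phi_meval.
    by apply: Va; exists (wdeg v m), f, k.
  have Gd : wdeg v m \in red_steps Gamma c.
    apply/mem_red_steps; split=> //.
      by rewrite (leq_trans dc) // leqSpred.
    by have [_ -> _] := hv; exists m.
  have m'0 : red Gamma v x (mmap1 x (min_solution v (wdeg v m))) = 0.
    rewrite redE; apply: reduce_self Gd; last exact: red_steps_sorted.
    by move=> d; exact: monic_monomial_monic.
  have E := wdeg_min_solution m v0.
  have [<-//|mN] := eqVneq (min_solution v (wdeg v m)) m.
  rewrite eq_sym in mN.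
  have [/Vf|/Vf] := @S_dec_binomial K _ _ _ _ mN (esym E);
    rewrite phi_XB redB m'0.
    by rewrite subr0.
  by rewrite sub0r => /eqP; rewrite oppr_eq0 => /eqP.
- have d0 : (0 < d)%N.
    rewrite lt0n; apply/eqP => dE; move/eqP: mm'; apply.
    by rewrite (wdeg_eq0 m v0 (etrans md dE)) (wdeg_eq0 m' v0 (etrans m'd dE)).
  rewrite red_phi_meval -/x phi_XB redB !H ?md ?m'd ?d0 //.
  by rewrite subrr coef0.
Qed.

(** * Algebras with a given semigroup *)

(** The order of a nonzero [r] would be in [Gamma], while [r] has no coefficient
    there. *)
Lemma semigroup_coef0 {K : comNzRingType} {c Gamma} (S : set (tpoly K c))
    (r : tpoly K c) :
  semigroup_of S = Gamma -> S r ->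
  (forall k, (k < c.-1.+1)%N -> Gamma k -> r`_k = 0) -> r = 0.
Proof.
move=> SG Sr r0; apply: contrapT => rN0.
have ex : exists k, r`_k != 0.
  apply: contrapT => H; apply: rN0; apply/npolyP => k; rewrite coef0.
  by apply/eqP/negPn/negP => rk; apply: H; exists k.
have [k rk kmin] := ex_minnP ex.
have kc : (k < c.-1.+1)%N.
  by rewrite ltnNge; apply/negP => ck; rewrite tpoly_coef_default ?eqxx in rk.
apply: (negP rk); apply/eqP; apply: r0 => //; rewrite -SG; left; exists r => //.
split; first exact: rk.
move=> l lk; apply/eqP; apply: contraLR lk => rl.
by rewrite -leqNgt kmin.
Qed.

Lemma monic_has_order {K : comNzRingType} {c} (r : tpoly K c) d :
  monic_of_order r d -> has_order r d.
Proof. by move=> [r1 r0]; split=> //; rewrite r1 oner_eq0. Qed.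

Lemma has_order_monic {K : fieldType} {c} (S : set (tpoly K c)) r d :
  subspace S -> S r -> has_order r d -> exists2 s, S s & monic_of_order s d.
Proof.
move=> [S0 SZ] Sr [rd r0]; exists ((r`_d)^-1 *: r).
  by rewrite -[X in S X]addr0; exact: SZ.
split=> [|k kd]; rewrite coefZ; first by rewrite mulVf.
by have -> : r`_k = 0 :> K by [exact: r0]; rewrite mulr0.
Qed.

(** An element of [Gamma] below [c] is the order of a monomial in the
    generators. *)
Lemma semigroup_of_generated_sup {K : comNzRingType} {Gamma c n}
    {v : 'I_n -> nat} (x : 'I_n -> tpoly K c) :
  minimal_generators Gamma v -> (forall i, leading_term (x i) (v i)) ->
  Gamma `<=` semigroup_of (generated_algebra x).
Proof.
move=> [_ -> _] xv _ [m <-]; have [dc|cd] := ltnP (wdeg v m) c; last by right.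
left; exists (mmap1 x m); first exact: generated_mmap1.
apply/monic_has_order/leading_term_monic; first exact: leading_term_mmap1.
by rewrite (leq_trans dc) // leqSpred.
Qed.

(** The reduction stays in [S], and it has no coefficient at any element of
    [Gamma]: those at positive elements are removed by the steps, and the
    constant one vanishes from the beginning. *)
Lemma red_eq0 {K : comNzRingType} {Gamma c n} {v : 'I_n -> nat}
    (x : 'I_n -> tpoly K c) (S : set (tpoly K c)) (r : tpoly K c) :
  minimal_generators Gamma v -> (forall i, leading_term (x i) (v i)) ->
  subspace S -> generated_algebra x `<=` S -> semigroup_of S = Gamma ->
  S r -> r`_0 = 0 -> red Gamma v x r = 0.
Proof.
move=> hv xv linS xS SG Sr r0; rewrite redE.
have q1 d : d \in red_steps Gamma c -> monic_of_order (monic_monomial v x d) d.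
  exact: monic_monomial_monic.
apply: (semigroup_coef0 S _ SG).
  apply/(mem_reduce S) => // d _; apply: xS; exact: generated_mmap1.
move=> [|k] kc Gk; last first.
  apply: coef_reduce_mem => //; first exact: red_steps_sorted.
  by apply/mem_red_steps.
rewrite (coef_reduce_order _ _ r 0%N q1 _).2 //.
by apply/negP => /mem_red_steps[].
Qed.

(** The elements that reduce to a constant form a subspace, which contains all
    monomials in the generators when the equations hold.  An element whose
    order is a gap does not belong to it. *)
Lemma RGamma_generated {K : comNzRingType} {Gamma c n} {v : 'I_n -> nat}
    (a : {ffun 'I_(M Gamma c v) -> K}) :
  Gamma 0%N -> conductor Gamma c -> minimal_generators Gamma v ->
  zero_locus (@red_coefficients K Gamma c n v) a ->
  RGamma Gamma (generated_algebra (normal_form a)).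
Proof.
move=> G0 hc hv /(zero_locusP _ hv) Va.
have v0 i : (0 < v i)%N := minimal_generators_gt0 i hv.
have xv := @leading_term_normal_form K Gamma c n v a.
set x := normal_form a in xv Va *.
split; first exact: generated_subalg.
apply/seteqP; split; last exact: (semigroup_of_generated_sup x hv xv).
move=> d [[r Rr [rd r0]]|cd]; last exact: (proj2 hc).
apply: contrapT => Gd.
have d0 : (0 < d)%N by rewrite lt0n; apply/eqP => dE; apply: Gd; rewrite dE.
have q1 e : e \in red_steps Gamma c -> monic_of_order (monic_monomial v x e) e.
  exact: monic_monomial_monic.
have [_ redd] := coef_reduce_order _ _ r d q1 r0.
move/negP: rd; apply; rewrite -redd; last by apply/negP => /mem_red_steps[].
pose C := [set s : tpoly K c | forall k, (0 < k)%N -> (red Gamma v x s)`_k = 0].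
suff xC : generated_algebra x `<=` C by apply/eqP; exact: (xC r Rr).
apply: generated_min_subspace => [|m k k0].
  split=> [k _|b s t Cs Ct k k0]; rewrite redE.
    by rewrite reduce_id ?coef0 // => e _; rewrite coef0.
  by rewrite reduce_linear coefD coefZ Cs // Ct // mulr0 addr0.
have [m0|mN0] := posnP (wdeg v m).
  have -> : mmap1 x m = 1 by rewrite (wdeg_eq0 m v0 m0) mmap11.
  have c1 l : (0 < l)%N -> (1 : tpoly K c)`_l = 0.
    move=> l0; rewrite -in_qpoly1 coef_in_qpolyXn coef1 gtn_eqF //.
    by case: ifP.
  rewrite redE reduce_id; first exact: c1.
  by move=> e /mem_red_steps[e0 _ _]; exact: c1.
have [mc|cm] := ltnP (wdeg v m) c; first by rewrite Va ?mN0 // coef0.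
rewrite (leading_term_eq0 _ _ (leading_term_mmap1 x v m xv)); last first.
  by have [->//|c0] := posnP c; rewrite prednK.
by rewrite redE reduce_id ?coef0 // => e _; rewrite coef0.
Qed.

(** The difference of the two normal forms lies in [S] and only has terms at
    gaps. *)
Lemma normal_form_inj {K : comNzRingType} {Gamma c n} {v : 'I_n -> nat}
    (a b : {ffun 'I_(M Gamma c v) -> K}) (S : set (tpoly K c)) :
  conductor Gamma c -> RGamma Gamma S ->
  (forall i, S (normal_form a i)) -> (forall i, S (normal_form b i)) -> a = b.
Proof.
move=> hc [algS SG] Sa Sb.
have [_ SZ] := subalg_subspace _ algS.
have E i : normal_form a i = normal_form b i.
  apply/eqP; rewrite -subr_eq0; apply/eqP; apply: (semigroup_coef0 S _ SG).
    by rewrite addrC -scaleN1r; exact: SZ.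
  move=> k kc Gk; have kg : k \notin gaps_above Gamma c (v i).
    by apply/negP => /mem_gaps[].
  by rewrite coefB !coef_normal_form_nongap // subrr.
apply/ffunP => l; rewrite -(tagnat.sigK l).
by case: (tagnat.sig l) => i j; rewrite -!coef_normal_form_gap E.
Qed.

Lemma normal_form_surj {K : comNzRingType} {Gamma c n} {v : 'I_n -> nat}
    (y : 'I_n -> tpoly K c) :
  (forall i k, (k < c.-1.+1)%N -> k \notin gaps_above Gamma c (v i) ->
     (y i)`_k = (k == v i)%:R) ->
  exists a : {ffun 'I_(M Gamma c v) -> K}, normal_form a = y.
Proof.
move=> yE; pose gs i := gaps_above Gamma c (v i).
exists [ffun l => let s := tagnat.sig l in
  (y (tag s))`_(nth 0%N (gs (tag s)) (tagged s))].
apply/funext => i; apply/npolyP => k.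
have [kc|kc] := ltnP k c.-1.+1; last by rewrite !tpoly_coef_default.
have [kg|kg] := boolP (k \in gs i); last first.
  by rewrite coef_normal_form_nongap // yE.
have kj : (index k (gs i) < size (gs i))%N by rewrite index_mem.
rewrite -[k](nth_index 0%N kg) (coef_normal_form_gap _ i (Ordinal kj)) ffunE.
by rewrite /= tagnat.rankK.
Qed.

(** An element of [S] of order [v i], made monic, is reduced against elements of
    [S] of each order in [Gamma] between [v i] and [c].  When [c <= v i], the
    normal form is zero. *)
Lemma normal_form_gens_exist {K : fieldType} {Gamma c n} {v : 'I_n -> nat}
    (S : set (tpoly K c)) :
  conductor Gamma c -> minimal_generators Gamma v -> RGamma Gamma S ->
  exists a : {ffun 'I_(M Gamma c v) -> K}, forall i, S (normal_form a i).
Proof.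
move=> hc hv [algS SG]; have linS := subalg_subspace _ algS.
have exq d : exists q : tpoly K c,
    Gamma d -> (d < c)%N -> S q /\ monic_of_order q d.
  have [[Gd dc]|H] := pselect (Gamma d /\ (d < c)%N); last first.
    by exists 0 => Gd dc; case: H.
  move: (Gd); rewrite -SG => -[[r Sr rd]|]; last by rewrite leqNgt dc.
  by have [s Ss s1] := has_order_monic S r d linS Sr rd; exists s.
have [q Sq] := choice exq.
pose ds i := [seq d <- red_steps Gamma c | (v i < d)%N].
have memds i d : d \in ds i <-> [/\ (v i < d)%N, (d < c.-1.+1)%N & Gamma d].
  rewrite mem_filter; split; first by case/andP=> -> /mem_red_steps[].
  case=> vd dc Gd; rewrite vd; apply/mem_red_steps; split=> //.
  exact: leq_ltn_trans vd.
(* Coefficients are truncated at c.-1.+1, which differs from c for c = 0. *)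
have cE d : (0 < d)%N -> (d < c.-1.+1)%N -> (d < c)%N.
  by move=> d0; have [->|c0] := posnP c; [case: d d0 | rewrite prednK].
have qds i d : d \in ds i -> S (q d) /\ monic_of_order (q d) d.
  case/memds=> vd dc Gd; apply: Sq => //; apply: cE => //.
  exact: leq_ltn_trans vd.
have Gv i : Gamma (v i).
  have [_ -> _] := hv; exists U_(i)%MM.
  rewrite /wdeg (bigD1 i) //= mnm1E eqxx mul1n.
  by rewrite big1 ?addn0 // => j ji; rewrite mnm1E eq_sym (negPf ji).
pose y i := if (v i < c)%N then reduce q (ds i) (q (v i)) else 0.
have Sy i : S (y i).
  rewrite /y; case: ifP => vc; last by case: linS.
  apply/(mem_reduce S) => //; first by move=> d /qds[].
  by have [] := Sq _ (Gv i) vc.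
have yE i k : (k < c.-1.+1)%N -> k \notin gaps_above Gamma c (v i) ->
    (y i)`_k = (k == v i)%:R.
  move=> kc kg; rewrite /y; case: ifP => vc; last first.
    rewrite coef0; case: eqP => // kv; move: vc; rewrite -kv cE // kv.
    exact: (minimal_generators_gt0 i hv).
  have qm d : d \in ds i -> monic_of_order (q d) d by case/qds.
  have [_ [q1 q0]] := Sq _ (Gv i) vc.
  have [kv|vk|kv] := ltngtP k (v i).
  - exact: (coef_reduce_order q (ds i) _ (v i) qm q0).1.
  - apply: coef_reduce_mem => //.
      by apply: sorted_filter; [exact: ltn_trans|exact: red_steps_sorted].
    by apply/memds; split=> //; exact: (notin_gaps hc kg).
  - rewrite kv; apply: etrans (coef_reduce_gt _ _ _ _ _) q1 => d dds.
    split; first exact: qm.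
    by case/memds: dds.
by have [a Ea] := normal_form_surj y yE; exists a; rewrite Ea.
Qed.

Lemma RGamma_zero_locus {K : comNzRingType} {Gamma c n} {v : 'I_n -> nat}
    (a : {ffun 'I_(M Gamma c v) -> K}) (S : set (tpoly K c)) :
  minimal_generators Gamma v -> RGamma Gamma S ->
  (forall i, S (normal_form a i)) ->
  zero_locus (@red_coefficients K Gamma c n v) a.
Proof.
move=> hv [algS SG] Sa; have xv := @leading_term_normal_form K Gamma c n v a.
have xS := generated_min_subalg _ S algS Sa.
apply/(zero_locusP _ hv) => m /andP[d0 dc].
apply: (red_eq0 _ S _ hv xv (subalg_subspace _ algS) xS SG).
  by apply: xS; exact: generated_mmap1.
have [_ m0] := leading_term_monic _ _ (leading_term_mmap1 _ _ m xv)
  (leq_trans dc (leqSpred c)).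
exact: m0.
Qed.

(** An element of [S] of zero constant term reduces to zero, so it is a
    combination of monomials in the generators. *)
Lemma RGamma_eq_generated {K : comNzRingType} {Gamma c n} {v : 'I_n -> nat}
    (a : {ffun 'I_(M Gamma c v) -> K}) (S : set (tpoly K c)) :
  minimal_generators Gamma v -> RGamma Gamma S ->
  (forall i, S (normal_form a i)) -> generated_algebra (normal_form a) = S.
Proof.
move=> hv [algS SG] Sa; have xv := @leading_term_normal_form K Gamma c n v a.
set x := normal_form a in xv Sa *.
have xS := generated_min_subalg x S algS Sa.
apply/seteqP; split=> // r Sr.
have algR := generated_subalg x.
have [S1 SZ _] := (subalg_closedP _).1 algS.
have [R1 RZ _] := (subalg_closedP _).1 algR.
pose r' : tpoly K c := - r`_0 *: 1 + r.
have r'0 : red Gamma v x r' = 0.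
  apply: (red_eq0 x S _ hv xv (subalg_subspace _ algS) xS SG); first exact: SZ.
  by rewrite coefD coefZ -in_qpoly1 coef_in_qpolyXn coef1 mulr1 addNr.
have linR := subalg_subspace _ algR.
have Rr' : generated_algebra x r'.
  apply/(mem_reduce _ (monic_monomial v x) (red_steps Gamma c) _ linR).
    by move=> d _; exact: generated_mmap1.
  by rewrite -redE r'0; case: linR.
have -> : r = r`_0 *: 1 + r' by rewrite addrA scaleNr subrr add0r.
exact: RZ.
Qed.

Lemma generated_algebra_bij {K : fieldType} {Gamma c n} {v : 'I_n -> nat} :
  Gamma 0%N -> conductor Gamma c -> minimal_generators Gamma v ->
  set_bij (zero_locus (@red_coefficients K Gamma c n v)) (@RGamma K Gamma c)
          (fun a => generated_algebra (normal_form a)).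
Proof.
move=> G0 hc hv; split=> [a Va|a b /set_mem Va _ E|S RS].
- exact: RGamma_generated.
- apply: (normal_form_inj a b _ hc (RGamma_generated a G0 hc hv Va)) => i.
    exact: generated_gen.
  by rewrite E; exact: generated_gen.
have [a Sa] := normal_form_gens_exist S hc hv RS.
exists a; last exact: RGamma_eq_generated.
exact: (RGamma_zero_locus a S).
Qed.

Theorem theorem2p22 (R : realType) (Gamma : set nat) (c g : nat)
    (v : 'I_g.+1 -> nat)
    (hGamma : numerical_semigroup Gamma)
    (hc : conductor Gamma c)
    (hv : minimal_generators Gamma v) :
  set_bij (zero_locus (@red_coefficients R[i] Gamma c g.+1 v))
          (@RGamma R[i] Gamma c)
          (fun a => generated_algebra (normal_form a)).
Proof.
by case: hGamma => G0 _ _; exact: (@generated_algebra_bij R[i]).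
Qed.
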